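(* Assume GCH. Let $\kappa<\lambda$ be infinite cardinals, let $D$ be a uniform ultrafilter on $\kappa$, let ${\bf B}_i$ be a Boolean algebra for every $i<\kappa$, and let ${\bf B}=\prod_{i<\kappa}{\bf B}_i/D$. Assume $\mathrm{Depth}({\bf B}_i)\le\lambda$ for every $i<\kappa$, and $\lambda=\lim_D\langle\mathrm{Depth}({\bf B}_i):i<\kappa\rangle$. Then $\mathrm{Depth}({\bf B})\le\lambda^+$.
   Context: For a Boolean algebra ${\bf B}$, $\mathrm{Depth}({\bf B})=\sup\{\theta : \text{there is a strictly increasing sequence } (b_\gamma:\gamma<\theta) \text{ in } {\bf B}\}$. An ultrafilter $D$ on $\kappa$ is uniform if every member of $D$ has cardinality $\kappa$. For a sequence of cardinals $\langle\theta_i:i<\kappa\rangle$, $\lim_D\langle\theta_i\rangle$ is the limit along $D$ in the order topology on cardinals, i.e. the cardinal $\lambda$ such that for every neighbourhood $U$ of $\lambda$ in the order topology, $\{i<\kappa:\theta_i\in U\}\in D$. *)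

(* Defs.v *)
From HB Require Import structures.
From mathcomp Require Import all_boot all_order generic_quotient.
From mathcomp Require Import mathcomp_extra boolp classical_sets functions.
From mathcomp Require Import cardinality filter.
From mathcomp Require wochoice.
Set Implicit Arguments.
Unset Strict Implicit.
Unset Printing Implicit Defensive.
Import Order.Theory.
Local Open Scope classical_set_scope.
Local Open Scope card_scope.

(* A cardinal is an equipotence class of types of one fixed universe u, hence
   lives in universe u + 1. Since the MathComp hierarchies are not universe
   polymorphic and are used at level u below, [cardinal] cannot be made an
   instance of their structures: its order and order topology are plain
   definitions. *)
Record cardinal := Cardinal {
  card_class : Type -> Prop;
  card_classP :
    exists T : Type, card_class = (fun X : Type => [set: X] #= [set: T])
}.

Declare Scope cardinal_scope.
Delimit Scope cardinal_scope with cardinal.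
Bind Scope cardinal_scope with cardinal.

Definition cardof (T : Type) (A : set T) : cardinal :=
  @Cardinal (fun X : Type => [set: X] #= [set: set_type A])
    (ex_intro _ (set_type A) erefl).

Definition card_carrier (c : cardinal) : Type := projT1 (cid (card_classP c)).

Definition cardinal_le (c d : cardinal) : Prop :=
  [set: card_carrier c] #<= [set: card_carrier d].
Definition cardinal_lt (c d : cardinal) : Prop := cardinal_le c d /\ c <> d.
Notation "c <= d" := (cardinal_le c d) : cardinal_scope.
Notation "c < d" := (cardinal_lt c d) : cardinal_scope.
Local Open Scope cardinal_scope.

Lemma cardinal_ext (c d : cardinal) : card_class c = card_class d -> c = d.
Proof.
case: c d => [P p] [Q q] /= PQ; rewrite -PQ in q *.
by congr Cardinal; exact: Prop_irrelevance.
Qed.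

Lemma cardof_eq (T U : Type) (A : set T) (B : set U) :
  cardof A = cardof B <-> A #= B.
Proof.
split=> [AB|AB].
  have /= E : card_class (cardof A) (set_type A) =
              card_class (cardof B) (set_type A) by rewrite AB.
  have h : [set: set_type A] #= [set: set_type B] by rewrite -E card_eqxx.
  by rewrite (card_eql (card_setT_sym A)) (card_eqr (card_setT_sym B)).
apply: cardinal_ext; apply/funext => X /=; congr is_true.
by rewrite (card_eqr (card_setT A)) (card_eqr (card_setT B)) (card_eqr AB).
Qed.

Lemma card_carrierK (c : cardinal) : cardof [set: card_carrier c] = c.
Proof.
apply: cardinal_ext; rewrite /card_carrier; case: cid => T /= ->.
by apply/funext => X; rewrite (card_eqr (card_setT _)).
Qed.

Lemma le_cardof (T U : Type) (A : set T) (B : set U) :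
  cardof A <= cardof B <-> A #<= B.
Proof.
have /cardof_eq hA := card_carrierK (cardof A).
have /cardof_eq hB := card_carrierK (cardof B).
by rewrite /cardinal_le (card_le_eql hA) (card_le_eqr hB).
Qed.

Lemma cardinal_le_refl (c : cardinal) : c <= c.
Proof. exact: card_lexx. Qed.

Lemma cardinal_le_anti (c d : cardinal) : c <= d -> d <= c -> c = d.
Proof.
move=> cd dc; rewrite -(card_carrierK c) -(card_carrierK d).
by apply/cardof_eq; rewrite card_eq_le; apply/andP.
Qed.

Lemma cardinal_le_trans (c d e : cardinal) : c <= d -> d <= e -> c <= e.
Proof. exact: card_le_trans. Qed.

Lemma inj_card_leT (T U : Type) (f : T -> U) :
  injective f -> [set: T] #<= [set: U].
Proof.
move=> finj; suff [g] : $|{injfun [set: T] >-> [set: U]}| by exact: inj_card_le g.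
by apply/injfunPex; exists f => // x y _ _; exact: finj.
Qed.

(* Any nonempty family of types has a member that injects in all the others:
   cardinals are totally ordered and well-founded. *)
Lemma card_le_min (I : Type) (i0 : I) (A : I -> Type) :
  exists i, forall j, [set: A i] #<= [set: A j].
Proof.
pose P (F : set (forall i, A i)) :=
  forall i f g, F f -> F g -> f i = g i -> f = g.
have [|F [PF Fmax]] := @Zorn_bigcup _ P.
  move=> C CP Ctot i f g [X CX Xf] [Y CY Yg].
  have [XY|YX] := Ctot _ _ CX CY; first exact: (CP _ CY i f g (XY _ Xf) Yg).
  exact: (CP _ CX i f g Xf (YX _ Yg)).
have [[i iF]|noi] := pselect (exists i, forall a, exists f, F f /\ f i = a).
  exists i => j.
  have [s sP] := choice iF.
  apply: (@inj_card_leT _ _ (fun a => s a j)) => a b /= E.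
  have [Fa <-] := sP a; have [Fb <-] := sP b.
  by rewrite (PF j _ _ Fa Fb E).
have h0 i : {a | forall f, F f -> f i <> a}.
  apply: cid; have /forallNP/(_ i)/existsNP[a na] := noi.
  by exists a => f Ff fa; apply: na; exists f.
pose h i := projT1 (h0 i).
have hP i f : F f -> f i <> h i by exact: (projT2 (h0 i)).
case: (Fmax (F `|` [set h])).
  split; first by move=> f Ff; left.
  by move=> /(_ h (or_intror erefl)) /(hP i0); exact.
move=> i f g [Ff|->] [Fg|->] //; first exact: PF.
- by move/(hP _ _ Ff).
- by move/esym/(hP _ _ Fg).
Qed.

Lemma cardinal_le_total (c d : cardinal) : c <= d \/ d <= c.
Proof.
have [[] h] := @card_le_min bool true
  (fun b => if b then card_carrier c else card_carrier d).
- by left; exact: (h false).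
- by right; exact: (h true).
Qed.

Definition is_least (S : cardinal -> Prop) (c : cardinal) : Prop :=
  S c /\ forall d, S d -> c <= d.

Lemma ex_least (S : cardinal -> Prop) :
  exists c, (exists d, S d) -> is_least S c.
Proof.
have [[c0 Sc0]|noS] := pselect (exists d, S d); last first.
  by exists (cardof [set: nat]) => /noS.
pose J := {A : set (card_carrier c0) | S (cardof A)}.
have j0 : J by exists [set: card_carrier c0]; rewrite card_carrierK.
have [[A SA] /= Amin] := @card_le_min J j0 (fun j => set_type (projT1 j)).
exists (cardof A) => _; split=> // d Sd.
have Sle (e : cardinal) : S e -> e <= c0 -> cardof A <= e.
  rewrite /cardinal_le => Se /card_leP[f].
  pose r (x : card_carrier e) := set_val (f (to_setT x)).
  have rinj : {in [set: card_carrier e] &, injective r}.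
    by move=> x y _ _ /val_inj /(inj (in_setT _) (in_setT _)) /(congr1 val).
  have E : cardof (range r) = e.
    by rewrite -[RHS]card_carrierK; apply/cardof_eq; exact: inj_card_eq.
  have Sr : S (cardof (range r)) by rewrite E.
  rewrite -/(cardinal_le _ _) -E; apply/le_cardof.
  rewrite -(card_le_eql (card_setT A)) -(card_le_eqr (card_setT _)).
  exact: (Amin (exist _ _ Sr)).
have [c0d|] := cardinal_le_total c0 d; last exact: Sle.
exact: cardinal_le_trans (Sle _ Sc0 (cardinal_le_refl _)) c0d.
Qed.

(* An arbitrary cardinal when [S] is empty. *)
Definition card_min (S : cardinal -> Prop) : cardinal := projT1 (cid (ex_least S)).

Lemma card_minP (S : cardinal -> Prop) (c : cardinal) :
  S c -> is_least S (card_min S).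
Proof. by move=> Sc; apply: (projT2 (cid (ex_least S))); exists c. Qed.

(* The least upper bound of [S], when [S] is bounded. *)
Definition card_sup (S : cardinal -> Prop) : cardinal :=
  card_min (fun c => forall d, S d -> d <= c).

Definition card_succ (c : cardinal) : cardinal := card_min (fun d => c < d).

Lemma card_lt_pow (c : cardinal) : c < cardof [set: set (card_carrier c)].
Proof.
rewrite -{1}(card_carrierK c); set T := card_carrier c; split.
  apply/le_cardof; apply: (@inj_card_leT _ _ (@set1 T)) => x y xy.
  have : [set x] x by [].
  by rewrite xy.
move=> /cardof_eq; rewrite card_eq_le => /andP[_ /card_leP[f]].
pose r (A : set T) := set_val (f (to_setT A)).
have rinj A B : r A = r B -> A = B.
  by move=> /val_inj /(inj (in_setT _) (in_setT _)) /(congr1 val).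
pose X : set T := fun x => exists2 A, r A = x & ~ A x.
have nX : ~ X (r X) by move=> XrX; have [A /rinj AX] := XrX; rewrite AX.
by apply: (nX); exists X.
Qed.

Lemma card_succP (c : cardinal) : is_least (fun d => c < d) (card_succ c).
Proof. exact: card_minP (card_lt_pow c). Qed.

(* Order topology on cardinals: the neighbourhoods of [c] are the sets that
   contain an open interval around [c]; [None] is an absent endpoint. *)
Definition card_itv (a b : option cardinal) (c : cardinal) : Prop :=
  (if a is Some a' then a' < c else True) /\
  (if b is Some b' then c < b' else True).

Definition card_nbhs (c : cardinal) (U : cardinal -> Prop) : Prop :=
  exists a b, card_itv a b c /\ forall e, card_itv a b e -> U e.

Definition card_lim (I : Type) (D : set_system I) (f : I -> cardinal)
    (c : cardinal) : Prop :=
  forall U : cardinal -> Prop, card_nbhs c U -> D [set i | U (f i)].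

(* The powerset of [T] is the type [set T]. *)
Definition GCH : Prop := forall T : Type, infinite_set [set: T] ->
  cardof [set: set T] = card_succ (cardof [set: T]).

Definition uniform (K : Type) (D : set_system K) : Prop :=
  forall A : set K, D A -> cardof A = cardof [set: K].

(* Well-orders of type an initial ordinal, that is, those that represent the
   cardinal [cardof [set: T]] as a von Neumann ordinal. *)
Definition initial_order (T : Type) (R : rel T) : Prop :=
  wochoice.well_order R /\
  forall x, cardof [set y | R y x /\ y <> x] < cardof [set: T].

Definition has_increasing_seq d (B : ctbDistrLatticeType d) (theta : cardinal)
    : Prop :=
  exists (T : Type) (R : rel T), [/\ cardof [set: T] = theta, initial_order R &
    exists b : T -> B, forall x y, R x y -> x <> y -> (b x < b y)%O].

(* The supremum is over cardinals [theta]; by [DepthP] it always exists. *)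
Definition Depth d (B : ctbDistrLatticeType d) : cardinal :=
  card_sup (has_increasing_seq B).

Lemma has_increasing_seq_le d (B : ctbDistrLatticeType d) (theta : cardinal) :
  has_increasing_seq B theta -> theta <= cardof [set: B].
Proof.
move=> [T [R [<- [woR _] [b bR]]]]; apply/le_cardof.
apply: (@inj_card_leT _ _ b) => x y bxy; apply: contrapT => xy.
have [|m [[/asboolP mxy mmin] _]] := woR (fun z => `[< z = x \/ z = y >]).
  by exists x; apply/asboolP; left.
have Rx : R m x by apply: mmin; apply/asboolP; left.
have Ry : R m y by apply: mmin; apply/asboolP; right.
case: mxy => ?; subst m.
  by have := bR _ _ Ry xy; rewrite bxy ltxx.
by have := bR _ _ Rx (fun h => xy (esym h)); rewrite bxy ltxx.
Qed.

Lemma DepthP d (B : ctbDistrLatticeType d) :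
  is_least (fun c => forall theta, has_increasing_seq B theta -> theta <= c)
    (Depth B).
Proof. exact: card_minP (@has_increasing_seq_le d B). Qed.

Section Ultraproduct.
Context (K : Type) (d : Order.disp_t) (B : K -> ctbDistrLatticeType d).

Definition product : Type := forall i, B i.
HB.instance Definition _ := gen_eqMixin product.
HB.instance Definition _ := gen_choiceMixin product.

Context (D : set_system K) {FD : Filter D}.

Definition modD (f g : product) : bool := `[< \forall i \near D, f i = g i >].

Lemma modD_refl : reflexive modD.
Proof. by move=> f; apply/asboolP; exact: nearW. Qed.

Lemma modD_sym : symmetric modD.
Proof.
by move=> f g; apply: asbool_equiv_eq; split; apply: filterS => i ->.
Qed.

Lemma modD_trans : transitive modD.
Proof.
move=> g f h /asboolP fg /asboolP gh; apply/asboolP.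
by apply: filterS2 fg gh => i -> ->.
Qed.

Canonical modD_equiv := EquivRel modD modD_refl modD_sym modD_trans.

Definition ultraproduct : Type := {eq_quot modD}%qT.
HB.instance Definition _ := Choice.on ultraproduct.

Definition ultra_cls (f : product) : ultraproduct := (\pi_({eq_quot modD}) f)%qT.
Definition ultra_rep (x : ultraproduct) : product := repr x.

Lemma ultra_repK x : ultra_cls (ultra_rep x) = x. Proof. exact: reprK. Qed.

Lemma ultra_clsP f g : ultra_cls f = ultra_cls g <-> \forall i \near D, f i = g i.
Proof.
split=> [/eqP|fg]; last by apply/eqmodP; apply/asboolP.
by move=> /eqP/eqmodP/asboolP.
Qed.

Lemma ultra_rep_cls f : \forall i \near D, ultra_rep (ultra_cls f) i = f i.
Proof. by apply/ultra_clsP; rewrite ultra_repK. Qed.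

Definition umeet (x y : ultraproduct) : ultraproduct :=
  ultra_cls (fun i => ultra_rep x i `&` ultra_rep y i)%O.
Definition ujoin (x y : ultraproduct) : ultraproduct :=
  ultra_cls (fun i => ultra_rep x i `|` ultra_rep y i)%O.
Definition ucompl (x : ultraproduct) : ultraproduct :=
  ultra_cls (fun i => ~` ultra_rep x i)%O.
Definition ubot : ultraproduct := ultra_cls (fun i => \bot)%O.
Definition utop : ultraproduct := ultra_cls (fun i => \top)%O.

Lemma umeetE f g : umeet (ultra_cls f) (ultra_cls g) = ultra_cls (fun i => f i `&` g i)%O.
Proof. by apply/ultra_clsP; apply: filterS2 (ultra_rep_cls f) (ultra_rep_cls g) => i -> ->. Qed.
Lemma ujoinE f g : ujoin (ultra_cls f) (ultra_cls g) = ultra_cls (fun i => f i `|` g i)%O.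
Proof. by apply/ultra_clsP; apply: filterS2 (ultra_rep_cls f) (ultra_rep_cls g) => i -> ->. Qed.
Lemma ucomplE f : ucompl (ultra_cls f) = ultra_cls (fun i => ~` f i)%O.
Proof. by apply/ultra_clsP; apply: filterS (ultra_rep_cls f) => i ->. Qed.

Lemma ultra_clsW f g : (forall i, f i = g i) -> ultra_cls f = ultra_cls g.
Proof. by move=> fg; apply/ultra_clsP; exact: nearW. Qed.

Let E := (umeetE, ujoinE, ucomplE).

Fact umeetC : commutative umeet.
Proof.
by move=> x y; rewrite -(ultra_repK x) -(ultra_repK y) !E; apply: ultra_clsW => i; rewrite meetC.
Qed.
Fact ujoinC : commutative ujoin.
Proof.
by move=> x y; rewrite -(ultra_repK x) -(ultra_repK y) !E; apply: ultra_clsW => i; rewrite joinC.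
Qed.
Fact umeetA : associative umeet.
Proof.
move=> x y z; rewrite -(ultra_repK x) -(ultra_repK y) -(ultra_repK z) !E.
by apply: ultra_clsW => i; rewrite meetA.
Qed.
Fact ujoinA : associative ujoin.
Proof.
move=> x y z; rewrite -(ultra_repK x) -(ultra_repK y) -(ultra_repK z) !E.
by apply: ultra_clsW => i; rewrite joinA.
Qed.
Fact ujoinKI y x : umeet x (ujoin x y) = x.
Proof.
by rewrite -(ultra_repK x) -(ultra_repK y) !E; apply: ultra_clsW => i; rewrite joinKI.
Qed.
Fact umeetKU y x : ujoin x (umeet x y) = x.
Proof.
by rewrite -(ultra_repK x) -(ultra_repK y) !E; apply: ultra_clsW => i; rewrite meetKU.
Qed.
Fact umeetUl : left_distributive umeet ujoin.
Proof.
move=> x y z; rewrite -(ultra_repK x) -(ultra_repK y) -(ultra_repK z) !E.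
by apply: ultra_clsW => i; rewrite meetUl.
Qed.
Fact umeetxx : idempotent_op umeet.
Proof. by move=> x; rewrite -(ultra_repK x) !E; apply: ultra_clsW => i; rewrite meetxx. Qed.

HB.instance Definition _ := Order.isMeetJoinDistrLattice.Build d ultraproduct
  (fun _ _ => erefl) (fun _ _ => erefl)
  umeetC ujoinC umeetA ujoinA ujoinKI umeetKU umeetUl umeetxx.

Fact ule0x (x : ultraproduct) : (ubot <= x)%O.
Proof.
by rewrite leEmeet -(ultra_repK x); apply/eqP; rewrite [LHS]umeetE; apply: ultra_clsW => i;
   rewrite meet0x.
Qed.
Fact ulex1 (x : ultraproduct) : (x <= utop)%O.
Proof.
by rewrite leEmeet -(ultra_repK x); apply/eqP; rewrite [LHS]umeetE; apply: ultra_clsW => i;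
   rewrite meetx1.
Qed.

HB.instance Definition _ := Order.hasBottom.Build d ultraproduct ule0x.
HB.instance Definition _ := Order.hasTop.Build d ultraproduct ulex1.

Fact ujoinxC (x : ultraproduct) : (x `|` ucompl x = \top)%O.
Proof.
by rewrite -(ultra_repK x) !E [LHS]ujoinE; apply: ultra_clsW => i; rewrite joinxC.
Qed.
Fact umeetxC (x : ultraproduct) : (x `&` ucompl x = \bot)%O.
Proof.
by rewrite -(ultra_repK x) !E [LHS]umeetE; apply: ultra_clsW => i; rewrite meetxC.
Qed.

HB.instance Definition _ := Order.TBDistrLattice_hasComplement.Build d ultraproduct
  ujoinxC umeetxC.

Lemma ultra_le_cls (f g : product) :
  (ultra_cls f <= ultra_cls g)%O <-> \forall i \near D, (f i <= g i)%O.
Proof.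
have -> : (ultra_cls f <= ultra_cls g)%O = (umeet (ultra_cls f) (ultra_cls g) == ultra_cls f) by [].
rewrite umeetE; split=> [/eqP/ultra_clsP|fg].
  by apply: filterS => i; rewrite leEmeet => ->.
by apply/eqP/ultra_clsP; apply: filterS fg => i; rewrite leEmeet => /eqP.
Qed.

End Ultraproduct.
Arguments ultraproduct {K d} B D {FD}.

(* Main.v *)
(* A strictly increasing sequence [a] of length [lambda^++] in the ultraproduct
   colours the pairs [x < y] by [{i | a_x i < a_y i}], a member of [D]. By GCH
   there are at most [2^K <= lambda] colours and [2^lambda = lambda^+], so the
   Erdős–Rado theorem gives a homogeneous set of size [lambda^+]; at any [i] in
   its colour, [a] is strictly increasing along that set, whence
   [Depth (B i) > lambda], a contradiction. *)
Require Import Defs.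
From HB Require Import structures.
From mathcomp Require Import all_boot all_order.
From mathcomp Require Import boolp classical_sets cardinality filter.
From mathcomp Require Import functions.
From mathcomp Require wochoice.
Local Open Scope classical_set_scope.
Local Open Scope card_scope.

(** * Comparison of cardinalities through explicit injections *)

Lemma card_le_inj {T U : Type} {A : set T} {B : set U} (f : T -> U) :
  (forall x, A x -> B (f x)) ->
  (forall x y, A x -> A y -> f x = f y -> x = y) -> A #<= B.
Proof.
move=> fAB finj; suff [g] : $|{injfun A >-> B}| by exact: inj_card_le g.
by apply/injfunPex; exists f => // x y /set_mem Ax /set_mem Ay; exact: finj.
Qed.

Lemma card_le_fun {T U : Type} {A : set T} {B : set U} (u0 : U) : A #<= B ->
  exists f : T -> U, (forall x, A x -> B (f x)) /\
    (forall x y, A x -> A y -> f x = f y -> x = y).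
Proof.
move=> /card_leP[g].
exists (fun x => if pselect (A x) is left Ax then set_val (g (SigSub (mem_set Ax)))
                 else u0); split=> [x Ax|x y Ax Ay]; case: pselect => // Ax'.
  exact: set_valP.
case: pselect => // Ay' /val_inj /(inj (in_setT _) (in_setT _)).
by move=> /(congr1 val).
Qed.

Lemma card_le_nonempty {T U : Type} {A : set T} {B : set U} :
  A #<= B -> A !=set0 -> B !=set0.
Proof.
move=> AB [x Ax]; apply: contrapT => /nonemptyPn B0.
by move: AB Ax; rewrite B0 => /card_le0P->.
Qed.

Lemma card_leX {T T' U U' : Type} (A : set T) (A' : set T') (B : set U)
    (B' : set U') :
  A #<= A' -> B #<= B' -> A `*` B #<= A' `*` B'.
Proof.
have [[[x0 y0] [/= Ax0 By0]]|/nonemptyPn->] :=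
  pselect ((A `*` B) !=set0); last by rewrite card_ge0.
move=> AA' BB'.
have [x1 _] := card_le_nonempty AA' (ex_intro _ x0 Ax0).
have [y1 _] := card_le_nonempty BB' (ex_intro _ y0 By0).
have [f [fA finj]] := card_le_fun x1 AA'; have [g [gB ginj]] := card_le_fun y1 BB'.
apply: (@card_le_inj _ _ _ _ (fun p => (f p.1, g p.2))) => [[x y] [/= /fA ? /gB] //|].
move=> [x y] [x' y'] [/= Ax By] [/= Ax' By'] [/(finj _ _ Ax Ax')-> /(ginj _ _ By By')->].
by [].
Qed.

Lemma card_le_set {T U : Type} :
  [set: T] #<= [set: U] -> [set: set T] #<= [set: set U].
Proof.
have [[t0]|T0 _] := pselect (inhabited T); last first.
  apply: (@card_le_inj _ _ _ _ (fun=> set0)) => // A B _ _ _.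
  by apply/funext => t; case: T0.
have [[u0]|U0 /card_leP[f]] := pselect (inhabited U); last first.
  by case: U0; exists; exact: set_val (f (to_setT t0)).
move=> /(card_le_fun u0)[f [_ finj]].
apply: (@card_le_inj _ _ _ _ (fun A : set T => f @` A)) => // A B _ _ AB.
have sub (X Y : set T) : f @` X = f @` Y -> X `<=` Y.
  move=> XY x Xx; have [y Yy /(finj _ _ I I) <- //] : (f @` Y) (f x).
  by rewrite -XY; exists x.
by rewrite eqEsubset; split; exact: sub.
Qed.

(** * Strict well-orders, initial segments and transfinite recursion *)

(** Well-foundedness feeds [Fix] directly; irreflexivity and transitivity follow from it and
    trichotomy, because a well-founded relation has no cycles. *)
Definition strict_well_order {T : Type} (lt : T -> T -> Prop) : Prop :=
  well_founded lt /\ forall x y, x <> y -> lt x y \/ lt y x.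

Section StrictWellOrder.
Context {T : Type} {lt : T -> T -> Prop}.
Hypothesis wo : strict_well_order lt.

Lemma swo_irr x : ~ lt x x.
Proof. by case: wo => wf _; elim: {x}(wf x) => x _ IH xx; exact: (IH x xx xx). Qed.

Lemma swo_asym x y : lt x y -> ~ lt y x.
Proof.
case: wo => wf _; elim: {x}(wf x) y => x _ IH y xy yx; exact: (IH y yx x yx xy).
Qed.

Lemma swo_trans x y z : lt x y -> lt y z -> lt x z.
Proof.
case: (wo) => wf tot xy yz; have [xz|] := pselect (x = z).
  by subst z; case: (swo_asym _ _ xy yz).
(* The cycle x < y < z < x is refuted by induction on its first element: rotated, it starts at the
   smaller z. *)
move=> /tot[//|zx]; exfalso; elim: {x}(wf x) y z xy yz zx => x _ IH y z xy yz zx.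
exact: (IH z zx x y zx xy yz).
Qed.

Lemma swo_min (S : set T) : S !=set0 ->
  exists x, S x /\ forall y, S y -> y = x \/ lt x y.
Proof.
case: (wo) => wf tot [x]; elim: {x}(wf x) => x _ IH Sx.
have [[y [Sy yx]]|h] := pselect (exists y, S y /\ lt y x); first exact: IH yx Sy.
exists x; split=> // y Sy; have [->|/tot[yx|]] := pselect (y = x); [by left| |by right].
by case: h; exists y.
Qed.

(** Cut [S] at the least x such that [S] still injects in its part below x; an injection in a
    shorter segment would contradict the choice of x. If there is no such x, [S] itself works. *)
Lemma initial_subset (S : set T) : exists A, [/\ A `<=` S, A #= S &
  forall x, A x -> ~ (A #<= [set y | A y /\ lt y x])].
Proof.
have [h|h] := pselect (exists x, S x /\ S #<= [set y | S y /\ lt y x]); last first.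
  by exists S; split=> // x Sx Sle; apply: h; exists x.
have [x [[Sx xle] xmin]] := swo_min _ h.
exists [set y | S y /\ lt y x]; split=> [y []//||y [Sy yx] le].
  by rewrite card_eq_le xle andbT; apply: subset_card_le => y [].
have [||] := xmin y; last by apply: swo_asym.
  split=> //; apply: card_le_trans xle _; apply: card_le_trans le _.
  by apply: subset_card_le => z [[]].
by move=> yx'; subst y; case: (swo_irr _ yx).
Qed.

(** Send each x of [A], by recursion, to an element of [B] not taken by the earlier elements of [A].
    If none were left, choosing a preimage for each element of [B] would inject [B] in the segment
    below x. *)
Lemma swo_card_le {U : Type} (A : set T) (B : set U) (u0 : U) :
  (forall x, A x -> ~ (B #<= [set y | A y /\ lt y x])) -> A #<= B.
Proof.
move=> AB; case: (wo) => wf tot.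
have step x (g : forall y, lt y x -> U) : {u | A x -> B u /\
    forall y (yx : lt y x), A y -> g y yx <> u}.
  apply: cid; apply: contrapT => noU.
  have [Ax|nAx] := pselect (A x); last by apply: noU; exists u0.
  have : forall u, exists y, B u -> exists yx : lt y x, A y /\ g y yx = u.
    move=> u; apply: contrapT => no; apply: noU; exists u => _; split.
      by apply: contrapT => nB; apply: no; exists x.
    by move=> y yx Ay gu; apply: no; exists y => _; exists yx.
  move=> /choice[r rP]; apply: (AB x Ax).
  apply: (@card_le_inj _ _ _ _ r) => [u /rP[yx []]//|u v Bu Bv uv].
  have [ux [_ <-]] := rP u Bu; have [vx [_ <-]] := rP v Bv.
  by move: ux vx; rewrite uv => ux vx; congr g; exact: Prop_irrelevance.
pose f := Fix wf (fun=> U) (fun x g => projT1 (step x g)).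
have fP x : A x -> B (f x) /\ forall y, lt y x -> A y -> f y <> f x.
  rewrite {1 3}/f Fix_eq; last first.
    move=> y g h gh; suff -> : g = h by [].
    by apply/functional_extensionality_dep => z; apply/functional_extensionality_dep.
  by move=> Ax; exact: (projT2 (step x (fun y _ => f y))).
apply: (@card_le_inj _ _ _ _ f) => [x /fP[]//|x y Ax Ay fxy].
apply: contrapT => /tot[xy|yx].
- by have [_ /(_ x xy Ax)] := fP y Ay.
- by have [_ /(_ y yx Ay)/nesym] := fP x Ax.
Qed.

End StrictWellOrder.

Lemma well_order_strict {T : Type} {R : rel T} : wochoice.well_order R ->
  strict_well_order (fun x y => R x y /\ x <> y).
Proof.
move=> wo; have mn (S : set T) : S !=set0 ->
    exists x, S x /\ forall y, S y -> R x y.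
  case=> x Sx; have [|m [[/asboolP Sm mmin] _]] := wo (fun z => `[< S z >]).
    by exists x; exact/asboolP.
  by exists m; split=> // y Sy; apply: mmin; exact/asboolP.
(* Antisymmetry comes from uniqueness of minima: both x and y would be minima of the pair. *)
have anti x y : R x y -> R y x -> x = y.
  move=> xy yx.
  have [|m [_ muniq]] := wo (fun z => `[< z = x \/ z = y >]).
    by exists x; apply/asboolP; left.
  have rfl z : R z z by have [|_ [-> /(_ z)]] := mn [set z]; [exists z|exact].
  rewrite -(muniq x) ?(muniq y) //; split.
  - by apply/asboolP; right.
  - by move=> z /asboolP[]->.
  - by apply/asboolP; left.
  - by move=> z /asboolP[]->.
split=> [x|x y xy].
  apply: contrapT => nx.
  have [|m [nm mmin]] := mn [set z | ~ Acc (fun x y => R x y /\ x <> y) z].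
    by exists x.
  apply: nm; constructor => y [ym neq]; apply: contrapT => /mmin my.
  by apply: neq; exact: anti.
have [|m [mxy mmin]] := mn [set z | z = x \/ z = y]; first by exists x; left.
case: mxy => ?; subst m.
- by left; split=> //; apply: mmin; right.
- by right; split; [apply: mmin; left|exact: nesym].
Qed.

Lemma strict_well_order_nonstrict {T : Type} {lt : T -> T -> Prop} :
  strict_well_order lt -> wochoice.well_order (fun x y => `[< x = y \/ lt x y >]).
Proof.
move=> wo A [a Aa].
have [|x [Ax xmin]] := swo_min wo (fun z => A z); first by exists a.
exists x; split.
  split=> // y Ay; apply/asboolP.
  by have [->|] := xmin y Ay; [left|right].
move=> y [Ay /(_ x Ax)/asboolP[//|yx]].
by have [//|/(swo_asym wo)] := xmin y Ay.
Qed.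

Lemma ex_strict_well_order (T : Type) :
  exists lt : T -> T -> Prop, strict_well_order lt.
Proof.
have [R /well_order_strict wo] := wochoice.well_ordering_principle {classic T}.
by eexists; exact: wo.
Qed.

(** * Squares of infinite cardinals *)

(** In a counterexample [A] of least cardinality and initial order type, order the pairs by their
    maximum. The pairs below q lie in the square of a proper segment of [A], which by minimality is
    too small to contain a copy of [A]; [swo_card_le] then injects the square in [A]. *)
Lemma card_setX_infinite {L : Type} : infinite_set [set: L] ->
  [set: L] `*` [set: L] #<= [set: L].
Proof.
move=> Linf; apply: contrapT => Lbad.
pose J := {A : set L | infinite_set A /\ ~ (A `*` A #<= A)}.
have j0 : J by exists [set: L].
have [[S [Sinf Sbad]] /= Smin] := card_le_min j0 (fun j => set_type (projT1 j)).
have {}Smin (A : set L) : infinite_set A -> ~ (S #<= A) -> A `*` A #<= A.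
  move=> Ainf SA; apply: contrapT => Abad; apply: SA.
  rewrite -(card_le_eql (card_setT S)) -(card_le_eqr (card_setT A)).
  exact: (Smin (exist _ A (conj Ainf Abad))).
have [lt wo] := ex_strict_well_order L.
have [A [AS AeqS Ainit]] := initial_subset wo S.
have {AeqS} [AleS SleA] : A #<= S /\ S #<= A.
  by move: AeqS; rewrite card_eq_le => /andP.
have Ainf : infinite_set A by move=> /(card_le_finite SleA).
have Abad : ~ (A `*` A #<= A).
  move=> AA; apply: Sbad; apply: card_le_trans (card_le_trans AA AleS).
  exact: card_leX.
have {}Smin (X : set L) : infinite_set X -> ~ (A #<= X) -> X `*` X #<= X.
  move=> Xinf AX; apply: Smin => // SX; apply: AX; exact: card_le_trans SX.
have [l0 _] := infinite_setN0 Ainf.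
have [ltW woW] := ex_strict_well_order (L * L).
(* Pairs are ordered by their maximum first; ties are broken arbitrarily. *)
pose m (p : L * L) := if pselect (lt p.1 p.2) then p.2 else p.1.
have m1 p : p.1 = m p \/ lt p.1 (m p).
  by rewrite /m; case: pselect => ? /=; [right|left].
have m2 p : p.2 = m p \/ lt p.2 (m p).
  rewrite /m; case: pselect => [?|n12] /=; first by left.
  have [->|/(proj2 wo)[|]] := pselect (p.2 = p.1); [by left|by right|by []].
pose lt2 p q := lt (m p) (m q) \/ (m p = m q /\ ltW p q).
have wo2 : strict_well_order lt2.
  split=> [p|p q pq].
    move Ex : (m p) => x; elim: {x}((proj1 wo) x) p Ex => x _ IH p.
    elim: {p}((proj1 woW) p) => p _ IHp mp; constructor => q [].
      by rewrite mp => /IH; apply.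
    by rewrite mp => -[mq /IHp]; apply.
  have [mpq|/(proj2 wo)[?|?]] := pselect (m p = m q); last 2 first.
  - by left; left.
  - by right; left.
  by have [?|?] := (proj2 woW) _ _ pq; [left|right]; right.
apply: Abad; apply: (swo_card_le wo2 _ _ l0) => q [Aq1 Aq2] Ale.
have Amq : A (m q) by rewrite /m; case: pselect.
pose X := [set y | A y /\ lt y (m q)]; pose Y := [set y | A y /\ (y = m q \/ lt y (m q))].
have {}Ale : A #<= Y `*` Y.
  apply: card_le_trans Ale _; apply: subset_card_le => p [[Ap1 Ap2] lpq].
  have mpq : m p = m q \/ lt (m p) (m q) by case: lpq => [?|[]]; [right|left].
  split; split=> //.
    case: mpq => [<-|mpq]; first exact: m1.
    by right; case: (m1 p) => [->//|h]; exact: swo_trans wo _ _ _ h mpq.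
  case: mpq => [<-|mpq]; first exact: m2.
  by right; case: (m2 p) => [->//|h]; exact: swo_trans wo _ _ _ h mpq.
have [Xfin|Xinf] := pselect (finite_set X).
  apply: Ainf; apply: card_le_finite Ale _; apply: finite_setX; rewrite -/Y.
    suff : finite_set (X `|` [set m q]).
      by apply: sub_finite_set => y [Ay []]; [right|left].
    by rewrite finite_setU.
  suff : finite_set (X `|` [set m q]).
    by apply: sub_finite_set => y [Ay []]; [right|left].
  by rewrite finite_setU.
have AX : ~ (A #<= X) by exact: Ainit.
have XX := Smin X Xinf AX; apply: AX.
suff YX : Y #<= X.
  by apply: card_le_trans Ale _; apply: card_le_trans XX; exact: card_leX.
apply: card_le_trans XX.
have [a Xa] := infinite_setN0 Xinf.
have [b [Xb ba]] : X `\` [set a] !=set0.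
  by apply: infinite_setN0; apply: infinite_setD.
have nXm : ~ X (m q) by case=> _ /(swo_irr wo).
(* [Y] exceeds [X] by the one point [m q], which is sent to (a, b); this is no (y, a), as b differs
   from a. *)
pose g y := if pselect (y = m q) then (a, b) else (y, a).
apply: (@card_le_inj _ _ _ _ g) => [y [Ay ymq]|x y _ _]; rewrite /g.
  by case: pselect => // nymq; split=> //; split=> //; case: ymq.
case: pselect => xm; case: pselect => ym //=; first by rewrite xm ym.
- by case=> _ /ba.
- by case=> _ /esym/ba.
- by case.
Qed.

(** * The Erdős-Rado tree and the partition theorem *)

Section ErdosRado.
Context {T C : Type} {lt : T -> T -> Prop} (wo : strict_well_order lt).
Context (c : T -> T -> C).

(* The strict order of the Erdős–Rado tree: its branches are end-homogeneous. *)
Definition er_tree : T -> T -> Prop :=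
  Fix (proj1 wo) (fun=> T -> Prop) (fun x below y =>
    lt x y /\ forall z (zx : lt z x), below z zx x -> c z x = c z y).

Lemma er_treeP x y :
  er_tree x y <-> lt x y /\ forall z, er_tree z x -> c z x = c z y.
Proof.
have E u v : er_tree u v = (lt u v /\
    forall z (zx : lt z u), er_tree z u -> c z u = c z v).
  rewrite {1}/er_tree Fix_eq // => w g h gh; suff -> : g = h by [].
  by apply/functional_extensionality_dep => z; apply/functional_extensionality_dep.
rewrite E; split=> -[xy h]; split=> // z; last by move=> _; exact: h.
by move=> zx; apply: (h z _ zx); move: zx; rewrite E => -[].
Qed.

Lemma er_tree_lt {x y} : er_tree x y -> lt x y.
Proof. by case/er_treeP. Qed.

Lemma er_tree_color {x y z} : er_tree z x -> er_tree x y -> c z x = c z y.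
Proof. by move=> zx /er_treeP[_]; apply. Qed.

Lemma er_tree_trans {x y z} : er_tree x y -> er_tree y z -> er_tree x z.
Proof.
elim: {x}((proj1 wo) x) y z => x _ IH y z xy yz; apply/er_treeP; split.
  exact: swo_trans wo _ _ _ (er_tree_lt xy) (er_tree_lt yz).
move=> t tx; rewrite (er_tree_color tx xy); apply: er_tree_color yz.
exact: IH (er_tree_lt tx) _ _ tx xy.
Qed.

(** Branches are chains: for z below x in the tree, [c z x] and [c z x'] both equal [c z y]. *)
Lemma er_tree_linear {x x' y} :
  er_tree x y -> er_tree x' y -> lt x x' -> er_tree x x'.
Proof.
elim: {x}((proj1 wo) x) => x _ IH xy x'y xx'; apply/er_treeP; split=> // z zx.
have zy := er_tree_trans zx xy.
have zx' : er_tree z x'.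
  by apply: IH zy x'y _; [exact: er_tree_lt|exact: swo_trans wo _ _ _ (er_tree_lt zx) xx'].
by rewrite (er_tree_color zx xy) (er_tree_color zx' x'y).
Qed.

(** If x came before y, the agreement of colours would put x below y in the tree, hence below
    itself. *)
Lemma er_tree_ext {x y} : (forall z, er_tree z x <-> er_tree z y) ->
  (forall z, er_tree z x -> c z x = c z y) -> x = y.
Proof.
move=> xy cxy; apply: contrapT => /(proj2 wo)[] h.
- have /xy/er_tree_lt/(swo_irr wo)// : er_tree x y by apply/er_treeP.
- have /xy/er_tree_lt/(swo_irr wo)// : er_tree y x.
  by apply/er_treeP; split=> // z /xy/cxy.
Qed.

Section Code.
Context {L : Type} (e : T -> T -> L).
Hypothesis e_inj : forall y x x', er_tree x y -> er_tree x' y ->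
  e y x = e y x' -> x = x'.

(* The isomorphism type of the coloured branch below [y], transported to [L];
   it determines [y] because equal codes force the branches to coincide. *)
Definition er_code (y : T) : set (L * L * C) := [set p | exists x x',
  [/\ er_tree x y, er_tree x' y, x = x' \/ er_tree x x' &
      p = (e y x, e y x', c x' y)]].

(** Diagonal triples of the code record which labels occur and with which colour; the others record
    the order. By induction on x, the element w of the branch of y' that carries the label of x has
    the same tree predecessors as x with the same colours, so w = x by [er_tree_ext]. *)
Lemma er_code_branch {y y'} : er_code y = er_code y' ->
  forall x, er_tree x y ->
    [/\ er_tree x y', e y x = e y' x & c x y = c x y'].
Proof.
move=> codeE x; elim: {x}((proj1 wo) x) => x _ IH xy.
have [u [w [uy' wy' _ [exu exw cxw]]]] : er_code y' (e y x, e y x, c x y).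
  by rewrite -codeE; exists x, x; split=> //; left.
have e_irr v z t : er_tree z v -> er_tree t v -> e v z = e v t -> ~ er_tree z t.
  by move=> zv tv /(e_inj _ _ _ zv tv)-> /er_tree_lt/(swo_irr wo).
suff xw : x = w by rewrite cxw exw {1 2 3}xw.
have sub z : er_tree z x -> er_tree z w.
  move=> zx; have zy := er_tree_trans zx xy.
  have [zy' ez _] := IH z (er_tree_lt zx) zy.
  have [z' [w' [z'y' w'y' z'w' [ez' ew' _]]]] : er_code y' (e y z, e y x, c x y).
    by rewrite -codeE; exists z, x; split=> //; right.
  have w'w : w' = w by apply: (e_inj _ _ _ w'y' wy'); rewrite -ew'.
  have z'z : z' = z by apply: (e_inj _ _ _ z'y' zy'); rewrite -ez'.
  move: z'w'; rewrite w'w z'z => -[zw|//].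
  by case: (e_irr y z x) => //; rewrite ez zw -w'w.
apply: er_tree_ext => [z|z zx]; last first.
  have [zy' _ cz] := IH z (er_tree_lt zx) (er_tree_trans zx xy).
  by rewrite (er_tree_color zx xy) cz (er_tree_color (sub z zx) wy').
(* Conversely, the triple of z and w is read back in the code of y; it gives some z' below x, and
   the induction hypothesis identifies z' with z. *)
split; [exact: sub|move=> zw]; have zy' := er_tree_trans zw wy'.
have [z' [x' [z'y x'y z'x' [ez' ex' _]]]] : er_code y (e y' z, e y' w, c w y').
  by rewrite codeE; exists z, w; split=> //; right.
have x'x : x' = x by apply: (e_inj _ _ _ x'y xy); rewrite -ex'.
move: z'x'; rewrite x'x => -[z'x|z'x].
  by case: (e_irr y' z w) => //; rewrite ez' z'x exw.
have [z'y' e' _] := IH z' (er_tree_lt z'x) z'y.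
by have <- : z' = z by apply: (e_inj _ _ _ z'y' zy'); rewrite ez'.
Qed.

Lemma er_code_inj : injective er_code.
Proof.
move=> y y' codeE; apply: er_tree_ext => z.
  split=> [/(er_code_branch codeE)|/(er_code_branch (esym codeE))];
    by case.
by case/(er_code_branch codeE).
Qed.

End Code.

End ErdosRado.

(* In arrow notation, [(2^L)^+ -> (L^+)^2_L]. *)
Theorem erdos_rado {T C L : Type} {lt : T -> T -> Prop} (c : T -> T -> C) :
  strict_well_order lt -> infinite_set [set: L] -> [set: C] #<= [set: L] ->
  ~ ([set: T] #<= [set: set L]) ->
  exists (H : set T) (k : C), ~ (H #<= [set: L]) /\
    forall x y, H x -> H y -> lt x y -> c x y = k.
Proof.
move=> wo Linf CL TL; have [l0 _] := infinite_setN0 Linf.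
have LL := card_setX_infinite Linf.
have [[y ybig]|small] :=
  pselect (exists y, ~ ([set x | er_tree wo c x y] #<= [set: L])); last first.
  (* If every branch injects in [L], the codes inject [T] in the powerset of [L * L * C], which is
     no larger than that of [L]. *)
  exfalso; apply: TL.
  have /choice[e eP] : forall y, exists e : T -> L, forall x x',
      er_tree wo c x y -> er_tree wo c x' y -> e x = e x' -> x = x'.
    move=> y; have [|e [_ einj]] :=
      @card_le_fun _ _ [set x | er_tree wo c x y] [set: L] l0.
      by apply: contrapT => ybig; apply: small; exists y.
    by exists e.
  apply: (card_le_trans (inj_card_leT (er_code_inj wo c e eP))).
  apply: card_le_set; rewrite -setXTT -setXTT.
  exact: card_le_trans (card_leX _ _ _ _ LL CL) LL.
apply: contrapT => noH; apply: ybig.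
(* Along the branch below y, [c x x'] equals [c x y], so the elements with [c x y = k] form a
   homogeneous set. If all these fibres inject in [L], the branch injects in [C * L], hence in
   [L]. *)
have fiber k : exists f : T -> L, forall x x', er_tree wo c x y -> c x y = k ->
    er_tree wo c x' y -> c x' y = k -> f x = f x' -> x = x'.
  pose F := [set x | er_tree wo c x y /\ c x y = k].
  have [|f [_ finj]] := @card_le_fun _ _ F [set: L] l0.
    apply: contrapT => big; apply: noH; exists F, k.
    split=> // x x' [xy <-] [x'y _] xx'.
    by rewrite (er_tree_color wo c (er_tree_linear wo c xy x'y xx') x'y).
  by exists f => x x' *; apply: finj.
have /choice[f fP] := fiber.
apply: card_le_trans LL; apply: (@card_le_trans _ _ _ ([set: C] `*` [set: L])); last first.
  exact: card_leX.
apply: (@card_le_inj _ _ _ _ (fun x => (c x y, f (c x y) x))) => // x x' /= xy x'y [cE].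
by rewrite cE; exact: fP.
Qed.

(** * Initial orders on subsets, and the bound on the depth of the ultraproduct *)

(** Puts the sets produced by [initial_subset] in the form that [has_increasing_seq] demands of an
    index. *)
Lemma initial_order_sub {T : Type} {lt : T -> T -> Prop} (A : set T) :
  strict_well_order lt ->
  (forall x, A x -> ~ (A #<= [set y | A y /\ lt y x])) ->
  initial_order (fun x y : set_type A => `[< x = y \/ lt (set_val x) (set_val y) >]).
Proof.
move=> wo Ainit.
have woA : strict_well_order (fun x y : set_type A => lt (set_val x) (set_val y)).
  split=> [x|x y xy].
    move Eu : (set_val x) => u; elim: {u}((proj1 wo) u) x Eu => u _ IH x xu.
    by constructor => y; rewrite xu => /IH; apply.
  by apply: (proj2 wo) => /val_inj.
split=> [|x]; first exact: strict_well_order_nonstrict.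
split; first by apply/le_cardof; exact: subset_card_le.
move=> /cardof_eq; rewrite card_eq_le => /andP[_ Ale].
apply: (Ainit (set_val x) (set_valP x)).
rewrite -(card_le_eql (card_setT A)); apply: card_le_trans Ale _.
apply: (@card_le_inj _ _ _ _ set_val) => [y [/asboolP[->//|yx] _]|y z _ _].
  by split=> //; exact: set_valP.
exact: val_inj.
Qed.

Theorem theorem3p1
    (gch : GCH)
    (K : Type) (lambda : cardinal)
    (K_infinite : infinite_set [set: K]%classic)
    (K_lt_lambda : (cardof [set: K]%classic < lambda)%cardinal)
    (D : set_system K) (D_ultra : UltraFilter D) (D_uniform : uniform D)
    (d : Order.disp_t) (B : K -> ctbDistrLatticeType d)
    (Depth_le : forall i, (Depth (B i) <= lambda)%cardinal)
    (Depth_lim : card_lim D (fun i => Depth (B i)) lambda) :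
  (Depth (ultraproduct B D) <= card_succ lambda)%cardinal.
Proof.
apply: (proj2 (DepthP _)) => theta [T [R [<- [woR _] [b bR]]]].
set L := card_carrier lambda.
have LE : cardof [set: L] = lambda := card_carrierK lambda.
have Linf : infinite_set [set: L].
  move=> /card_le_finite h; apply: K_infinite; apply: h.
  by apply/le_cardof; rewrite LE; case: K_lt_lambda.
(* The colours are subsets of [K]; by GCH there are as many as the successor of the cardinal of [K],
   which is at most [lambda]. *)
have KL : [set: set K] #<= [set: L].
  apply/le_cardof; rewrite gch // LE; exact: (proj2 (card_succP _)).
rewrite -LE -gch //; apply/le_cardof; apply: contrapT => Tbig.
pose a x : forall i, B i := ultra_rep (b x).
have wo := well_order_strict woR.
have [H [k [Hbig Hk]]] :=
  erdos_rado (fun x y => [set i | (a x i < a y i)%O]) wo Linf KL Tbig.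
(* Without two distinct elements, [H] would inject in [L] by a constant map. *)
have [x [y [Hx Hy xy]]] : exists x y, [/\ H x, H y & R x y /\ x <> y].
  apply: contrapT => no; apply: Hbig; have [l0 _] := infinite_setN0 Linf.
  apply: (@card_le_inj _ _ _ _ (fun=> l0)) => // x y Hx Hy _; apply: contrapT.
  by move=> /(proj2 wo)[]?; apply: no; [exists x, y|exists y, x].
have Dk : D k.
  rewrite -(Hk x y Hx Hy xy).
  have : (b x < b y)%O by apply: bR; case: xy.
  rewrite Order.POrderTheory.lt_def => /andP[byx].
  rewrite -(ultra_repK (b x)) -(ultra_repK (b y)) => /ultra_le_cls le_xy.
  (* Here the ultrafilter property turns inequality of the classes into inequality of
     representatives on a member of [D]. *)
  have ne_xy : D [set i | a x i <> a y i].
    have [E|//] := in_ultra_setVsetC [set i | a x i = a y i] D_ultra.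
    case/eqP: byx; rewrite -(ultra_repK (b x)) -(ultra_repK (b y)).
    by apply/ultra_clsP; apply: filterS E => i; exact: esym.
  apply: filterS2 le_xy ne_xy => i xy_i /eqP ne.
  by rewrite /= Order.POrderTheory.lt_neqAle ne.
have [i ki] := filter_ex Dk.
have succL : (card_succ lambda <= cardof H)%cardinal.
  apply: (proj2 (card_succP _)); have [|Hle] := cardinal_le_total lambda (cardof H).
    by split=> // LH; apply: Hbig; apply/le_cardof; rewrite LE LH; exact: cardinal_le_refl.
  by case: Hbig; apply/le_cardof; rewrite LE.
(* [H] need not have initial order type, so it is replaced by an equipotent subset that does. *)
have [A [AH AeqH Ainit]] := initial_subset wo H.
have : (cardof [set: set_type A] <= Depth (B i))%cardinal.
  apply: (proj1 (DepthP _)); eexists; eexists; split; [by []|exact: initial_order_sub Ainit|].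
  exists (fun x => a (set_val x) i) => u v /asboolP[//|uv] _.
  suff : k i by rewrite -(Hk _ _ _ _ uv) //; apply: AH; exact: set_valP.
  exact: ki.
have -> : cardof [set: set_type A] = cardof H.
  by apply/cardof_eq; rewrite (card_eql (card_setT A)).
(* The successor of [lambda] is at most the cardinal of [H], hence at most [Depth (B i)] and so at
   most [lambda], which is absurd. *)
move=> HD; have [+ []] := proj1 (card_succP lambda).
move=> h; apply: cardinal_le_anti => //; apply: cardinal_le_trans succL _.
exact: cardinal_le_trans HD (Depth_le i).
Qed.
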